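(* Let $\mathcal V$ be the category of normed (resp. seminormed) vector spaces over $\mathbb R$ or $\mathbb C$ with nonexpansive linear maps, let $\mathbb T$ be the double-dualization $\mathcal V$-monad on $\underline{\mathcal V}$, and let $(\mathcal E,\mathcal M)$ be the $\mathcal V$-factorization-system on $\underline{\mathcal V}$ in which $\mathcal E$ consists of the surjective morphisms and $\mathcal M$ of the isometric embeddings. Then: (1) A morphism in $\mathcal V$ is $\mathbb T$-dense if and only if it is dense. (2) A morphism in $\mathcal V$ is a $\mathbb T$-closed $\mathcal M$-embedding if and only if it is a closed isometric embedding. (3) Every morphism in $\mathcal V$ factors as a $\mathbb T$-dense morphism followed by a $\mathbb T$-closed $\mathcal M$-embedding. (4) The $\mathbb T$-closure of a subspace $V\hookrightarrow W$ of a normed (resp. seminormed) vector space $W$ is the usual closure $\overline V\hookrightarrow W$ of $V$ in $W$.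
   Context: $\mathcal V$ is either $\mathbf{Norm}_1$ or $\mathbf{SNorm}_1$: normed, resp. seminormed, vector spaces over $R=\mathbb R$ or $\mathbb C$, with linear maps that are nonexpansive ($\|f(v)\|\le\|v\|$). $\mathcal V$ is symmetric monoidal closed: the internal hom $\underline{\mathcal V}(V,W)$ is the space of all bounded linear maps $V\to W$ with the operator (semi)norm, and the monoidal product is the algebraic tensor product with the projective (semi)norm. $\underline{\mathcal V}$ is $\mathcal V$ viewed as a $\mathcal V$-category. With $V^*=\underline{\mathcal V}(V,R)$, the double-dualization $\mathcal V$-monad $\mathbb T=(T,\eta,\mu)$ is induced by the $\mathcal V$-adjunction $(-)^*\dashv(-)^*:\underline{\mathcal V}^{\mathrm{op}}\to\underline{\mathcal V}$, so $TV=V^{**}$ and $\eta_V$ is the canonical evaluation map. A morphism is dense if its image is dense in its codomain; an isometric embedding is an injective linear map with $\|h(v)\|=\|v\|$; it is closed if its image is closed. A subspace carries the restricted (semi)norm. For $e:A_1\to A_2$ and $m:B_1\to B_2$ in a $\mathcal V$-category $\mathcal B$, write $e\downarrow_{\mathcal V}m$ if the commutative square with sides $\mathcal B(A_2,m),\mathcal B(e,B_1),\mathcal B(e,B_2),\mathcal B(A_1,m)$ exhibits $\mathcal B(A_2,B_1)$ as the pullback of $\mathcal B(A_1,B_1)\to\mathcal B(A_1,B_2)\leftarrow\mathcal B(A_2,B_2)$ in $\mathcal V$. For a class $\mathcal H$ of morphisms, $\mathcal H^{\downarrow_{\mathcal V}}=\{m\mid\forall e\in\mathcal H:e\downarrow_{\mathcal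 V}m\}$ and $\mathcal H^{\uparrow_{\mathcal V}}=\{e\mid\forall m\in\mathcal H:e\downarrow_{\mathcal V}m\}$. $(\mathcal E,\mathcal M)$ is a $\mathcal V$-factorization-system if $\mathcal E^{\downarrow_{\mathcal V}}=\mathcal M$, $\mathcal M^{\uparrow_{\mathcal V}}=\mathcal E$, and every morphism factors as one in $\mathcal E$ followed by one in $\mathcal M$. Morphisms in $\mathcal M$ are called $\mathcal M$-embeddings. $\Sigma_T$ is the class of morphisms sent by $T$ to isomorphisms. An $\mathcal M$-embedding is $\mathbb T$-closed if it lies in $\Sigma_T^{\downarrow_{\mathcal V}}$. A morphism is $\mathbb T$-dense if it lies in $(\Sigma_T^{\downarrow_{\mathcal V}}\cap\mathcal M)^{\uparrow_{\mathcal V}}$. The $\mathbb T$-closure of an $\mathcal M$-embedding $m$ is the second factor of the (essentially unique) factorization of $m$ as a $\mathbb T$-dense morphism followed by a $\mathbb T$-closed $\mathcal M$-embedding. *)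

(* Defs.v *)
From HB Require Import structures.
From mathcomp Require Import all_boot all_order all_algebra.
From mathcomp Require Import boolp classical_sets functions reals topology.
From mathcomp Require Import complex.

Set Implicit Arguments.
Unset Strict Implicit.
Unset Printing Implicit Defensive.
Import Order.TTheory GRing.Theory Num.Theory.
Local Open Scope classical_set_scope.
Local Open Scope ring_scope.

Variant scalar_kind := RealScalars | ComplexScalars.
Variant norm_kind := Normed | Seminormed.

Definition scalars (R : realType) (k : scalar_kind) : numFieldType :=
  match k with
  | RealScalars => R
  | ComplexScalars => complex R
  end.

(* Real-valued modulus; the library's norm on [complex R] is valued in
   [complex R] itself. *)
Definition modulus (R : realType) (k : scalar_kind) : scalars R k -> R :=
  match k return scalars R k -> R with
  | RealScalars => fun x => `|x|
  | ComplexScalars => @ComplexField.Normc.normc R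
  end.

Section Modulus.
Context {R : realType} {k : scalar_kind}.
Implicit Types a b : scalars R k.

Lemma modulus_ge0 a : 0 <= modulus a.
Proof. by case: k a => a /=; [exact: normr_ge0|case: a => *; exact: sqrtr_ge0]. Qed.

Lemma modulusD a b : modulus (a + b) <= modulus a + modulus b.
Proof. by case: k a b => a b; [exact: ler_normD|exact: le_normcD]. Qed.

Lemma modulusM a b : modulus (a * b) = modulus a * modulus b.
Proof. by case: k a b => a b; [exact: normrM|exact: ComplexField.Normc.normcM]. Qed.

Lemma modulus_eq0 a : modulus a = 0 -> a = 0.
Proof.
by case: k a => a /=; [exact: normr0_eq0|exact: ComplexField.Normc.eq0_normc].
Qed.

Lemma modulus0 : modulus (0 : scalars R k) = 0.
Proof. by case: k; [exact: normr0|exact: ComplexField.Normc.normc0]. Qed.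

Lemma modulus1 : modulus (1 : scalars R k) = 1.
Proof. by case: k; [exact: normr1|exact: ComplexField.Normc.normc1]. Qed.

Lemma modulusN1 : modulus (-1 : scalars R k) = 1.
Proof.
have /eqP := modulusM (-1) (-1).
rewrite mulrNN mulr1 modulus1 eq_sym -expr2 sqrf_eq1 => /orP[/eqP//|/eqP e].
by have := modulus_ge0 (-1); rewrite e ler0N1.
Qed.

End Modulus.
Arguments modulus : simpl never.

(* The objects of Norm_1 (for [d := Normed]) and of SNorm_1 (for
   [d := Seminormed]). *)
Record nspace (R : realType) (k : scalar_kind) (d : norm_kind) := NSpace {
  nspace_lmod : lmodType (scalars R k) ;
  nspace_norm : nspace_lmod -> R ;
  nspace_normD : forall x y,
    nspace_norm (x + y) <= nspace_norm x + nspace_norm y ;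
  nspace_normZ : forall (a : scalars R k) x,
    nspace_norm (a *: x) = modulus a * nspace_norm x ;
  nspace_norm_eq0 : d = Normed -> forall x, nspace_norm x = 0 -> x = 0
}.

Definition nspace_sort R k d (V : nspace R k d) : Type := nspace_lmod V.
Coercion nspace_sort : nspace >-> Sortclass.

HB.instance Definition _ R k d (V : nspace R k d) :=
  GRing.Lmodule.copy (nspace_sort V) (nspace_lmod V).

Definition snorm R k d (V : nspace R k d) : V -> R := @nspace_norm R k d V.

Section SnormTheory.
Context {R : realType} {k : scalar_kind} {d : norm_kind}.
Variable V : nspace R k d.
Implicit Types x y : V.

Lemma snormD x y : snorm (x + y) <= snorm x + snorm y.
Proof. exact: nspace_normD. Qed.

Lemma snormZ (a : scalars R k) x : snorm (a *: x) = modulus a * snorm x.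
Proof. exact: nspace_normZ. Qed.

Lemma snorm_eq0 : d = Normed -> forall x, snorm x = 0 -> x = 0.
Proof. exact: nspace_norm_eq0. Qed.

Lemma snorm0 : snorm (0 : V) = 0.
Proof. by rewrite -(scale0r 0) snormZ modulus0 mul0r. Qed.

Lemma snormN x : snorm (- x) = snorm x.
Proof. by rewrite -scaleN1r snormZ modulusN1 mul1r. Qed.

Lemma snorm_ge0 x : 0 <= snorm x.
Proof.
rewrite -(pmulrn_lge0 _ (isT : (0 < 2)%N)) mulr2n.
by rewrite -[X in _ + X]snormN -snorm0 -(subrr x) snormD.
Qed.

Lemma snormB x y : snorm (x - y) = snorm (y - x).
Proof. by rewrite -snormN opprB. Qed.

Lemma snorm_triangle y x z : snorm (x - z) <= snorm (x - y) + snorm (y - z).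
Proof. by rewrite -[x in leLHS](subrK y) -addrA snormD. Qed.

End SnormTheory.

(* The topology of the pseudometric |x - y|, so that [closure], [closed] and
   [dense] below are those of the library. *)
Section SnormTopology.
Context {R : realType} {k : scalar_kind} {d : norm_kind}.
Variable V : nspace R k d.

Definition sball (x : V) (e : R) : set V := [set y | snorm (x - y) < e].
Definition sent : set_system (V * V) := entourage_ sball.
Definition snbhs (x : V) : set_system V := nbhs_ sent x.

HB.instance Definition _ := hasNbhs.Build (nspace_sort V) snbhs.

Lemma snbhsE : (nbhs : V -> set_system V) = nbhs_ sent.
Proof. by []. Qed.

Lemma sball_center x (e : R) : 0 < e -> sball x e x.
Proof. by rewrite /sball/= subrr snorm0. Qed.

Lemma sball_sym x y (e : R) : sball x e y -> sball y e x.
Proof. by rewrite /sball/= snormB. Qed.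

Lemma sball_triangle x y z (e1 e2 : R) :
  sball x e1 y -> sball y e2 z -> sball x (e1 + e2) z.
Proof.
by rewrite /sball/= => ? ?; rewrite (le_lt_trans (snorm_triangle y _ _))// ltrD.
Qed.

HB.instance Definition _ := @Nbhs_isPseudoMetric.Build R (nspace_sort V)
  sent snbhsE sball sball_center sball_sym sball_triangle erefl.

Lemma snorm_closureP (A : set V) x :
  closure A x <-> forall e : R, 0 < e -> exists2 y, A y & snorm (x - y) < e.
Proof.
split=> [clA e e0|H B /nbhs_ballP[e /= e0 eB]].
  by have [|y [Ay xy]] := clA (ball x e); [exact: nbhsx_ballx|exists y].
by have [y Ay xy] := H e e0; exists y; split=> //; apply: eB.
Qed.

End SnormTopology.

Section Category.
Context {R : realType} {k : scalar_kind} {d : norm_kind}.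
Local Notation K := (scalars R k).
Local Notation nspace := (nspace R k d).
Implicit Types U V W : nspace.

Record mor V W := Mor {
  mor_fun :> V -> W ;
  mor_linear : linear mor_fun ;
  mor_nonexpansive : forall x, snorm (mor_fun x) <= snorm x
}.

HB.instance Definition _ V W (f : mor V W) :=
  GRing.isLinear.Build K V W *:%R (mor_fun f) (mor_linear f).

Lemma mor_eqP V W (f g : mor V W) : f =1 g -> f = g.
Proof.
case: f g => [f fl fn] [g gl gn] /= /funext fg; move: fl fn gl gn; rewrite fg.
by move=> *; congr Mor; exact: Prop_irrelevance.
Qed.

Lemma idm_nonexpansive V (x : V) : snorm (idfun x) <= snorm x.
Proof. by []. Qed.

Definition idm V : mor V V :=
  @Mor V V idfun (fun _ _ _ => erefl) (@idm_nonexpansive V).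

Lemma compm_linear U V W (g : mor V W) (f : mor U V) : linear (g \o f).
Proof. by move=> a x y /=; rewrite !linearP. Qed.

Lemma compm_nonexpansive U V W (g : mor V W) (f : mor U V) x :
  snorm ((g \o f) x) <= snorm x.
Proof. exact: le_trans (mor_nonexpansive _ _) (mor_nonexpansive _ _). Qed.

Definition compm U V W (g : mor V W) (f : mor U V) : mor U W :=
  Mor (compm_linear g f) (compm_nonexpansive g f).

Definition is_iso V W (f : mor V W) : Prop :=
  exists g : mor W V, compm g f = idm V /\ compm f g = idm W.

Definition is_pullback P A B C
    (p : mor P A) (q : mor P B) (f : mor A C) (g : mor B C) : Prop :=
  compm f p = compm g q /\
  forall Q (u : mor Q A) (v : mor Q B), compm f u = compm g v ->
    exists! h : mor Q P, compm p h = u /\ compm q h = v.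

Definition bounded_linear V W : {pred V -> W} :=
  [pred f | `[< linear f /\
                exists C : R, forall x, snorm (f x) <= C * snorm x >]].
Arguments bounded_linear : clear implicits.

Lemma bounded_linearP V W (f : V -> W) :
  reflect (linear f /\ exists C : R, forall x, snorm (f x) <= C * snorm x)
          (f \in bounded_linear V W).
Proof. exact: asboolP. Qed.

Lemma bounded_linear_submod V W : subsemimod_closed (bounded_linear V W).
Proof.
apply: GRing.submod_closed_semi.
split=> [|a f g /bounded_linearP[fl [C fC]] /bounded_linearP[gl [D gD]]].
  apply/bounded_linearP; split=> [a x y|]; first by rewrite scaler0 addr0.
  by exists 0 => x; rewrite mul0r snorm0.
apply/bounded_linearP; split=> [b x y|].
  change (a *: f (b *: x + y) + g (b *: x + y) =
          b *: (a *: f x + g x) + (a *: f y + g y)).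
  rewrite fl gl !scalerDr !scalerA (mulrC a) -!addrA; congr (_ + _).
  by rewrite addrCA.
exists (modulus a * C + D) => x.
rewrite mulrDl (le_trans (snormD _ _))// lerD//.
by rewrite snormZ -mulrA ler_wpM2l// modulus_ge0.
Qed.

HB.instance Definition _ V W :=
  GRing.isSubmodClosed.Build K (V -> W) (bounded_linear V W)
    (@bounded_linear_submod V W).

Record bmap V W := BMap {
  bmap_fun :> V -> W ;
  bmap_subproof : bmap_fun \in bounded_linear V W
}.

HB.instance Definition _ V W := [isSub for @bmap_fun V W].
HB.instance Definition _ V W := [Choice of bmap V W by <:].
HB.instance Definition _ V W := [SubChoice_isSubLmodule of bmap V W by <:].

Lemma bmap_linear V W (f : bmap V W) : linear f.
Proof. by have /bounded_linearP[] := bmap_subproof f. Qed.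

HB.instance Definition _ V W (f : bmap V W) :=
  GRing.isLinear.Build K V W *:%R (bmap_fun f) (bmap_linear f).

Lemma bmap_eqP V W (f g : bmap V W) : f =1 g -> f = g.
Proof. by move=> fg; apply: val_inj; exact/funext. Qed.

Lemma bmapD V W (f g : bmap V W) x : (f + g) x = f x + g x.
Proof. by []. Qed.

Lemma bmapZ V W (a : K) (f : bmap V W) x : (a *: f) x = a *: f x.
Proof. by []. Qed.

Definition opnorm_bounds V W (f : bmap V W) : set R :=
  [set C | 0 <= C /\ forall x, snorm (f x) <= C * snorm x].

Definition opnorm V W (f : bmap V W) : R := inf (opnorm_bounds f).

Lemma opnorm_has_inf V W (f : bmap V W) : has_inf (opnorm_bounds f).
Proof.
have /bounded_linearP[_ [C fC]] := bmap_subproof f; split; last first.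
  by exists 0 => D [].
exists `|C|; split=> // x; apply: le_trans (fC x) _.
by rewrite ler_wpM2r ?snorm_ge0// ler_norm.
Qed.

Lemma opnorm_ge0 V W (f : bmap V W) : 0 <= opnorm f.
Proof. by apply: lb_le_inf; [case: (opnorm_has_inf f)|move=> C []]. Qed.

Lemma opnorm_le V W (f : bmap V W) (C : R) : 0 <= C ->
  (forall x, snorm (f x) <= C * snorm x) -> opnorm f <= C.
Proof. by move=> C0 fC; apply: ge_inf => //; case: (opnorm_has_inf f). Qed.

Lemma opnormP V W (f : bmap V W) x : snorm (f x) <= opnorm f * snorm x.
Proof.
have := snorm_ge0 x; rewrite le_eqVlt => /predU1P[x0|x0].
  have [[C [_ /(_ x) fC]] _] := opnorm_has_inf f.
  by move: fC; rewrite -x0 !mulr0.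
rewrite -ler_pdivrMr//; apply: lb_le_inf; first by case: (opnorm_has_inf f).
by move=> C [_ fC]; rewrite ler_pdivrMr.
Qed.

Lemma opnormD V W (f g : bmap V W) : opnorm (f + g) <= opnorm f + opnorm g.
Proof.
apply: opnorm_le => [|x]; first by rewrite addr_ge0 ?opnorm_ge0.
by rewrite bmapD mulrDl (le_trans (snormD _ _))// lerD ?opnormP.
Qed.

Lemma opnormZ_le V W (a : K) (f : bmap V W) :
  opnorm (a *: f) <= modulus a * opnorm f.
Proof.
apply: opnorm_le => [|x]; first by rewrite mulr_ge0 ?opnorm_ge0 ?modulus_ge0.
by rewrite bmapZ snormZ -mulrA ler_wpM2l ?modulus_ge0 ?opnormP.
Qed.

Lemma opnormZ V W (a : K) (f : bmap V W) :
  opnorm (a *: f) = modulus a * opnorm f.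
Proof.
apply/le_anti; rewrite opnormZ_le /=.
have [->|a0] := eqVneq a 0; first by rewrite modulus0 mul0r opnorm_ge0.
have ma : modulus a * modulus a^-1 = 1 by rewrite -modulusM divff// modulus1.
have := opnormZ_le a^-1 (a *: f); rewrite scalerA mulVf// scale1r.
by move=> /(ler_wpM2l (modulus_ge0 a)); rewrite mulrA ma mul1r.
Qed.

Lemma opnorm_eq0 V W : d = Normed -> forall f : bmap V W, opnorm f = 0 -> f = 0.
Proof.
move=> dN f f0; apply: bmap_eqP => x; apply: (snorm_eq0 dN).
by apply/le_anti; rewrite snorm_ge0 (le_trans (opnormP f x))// f0 mul0r.
Qed.

Definition hom V W : nspace :=
  @NSpace R k d (bmap V W) (@opnorm V W) (@opnormD V W) (@opnormZ V W)
    (@opnorm_eq0 V W).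

Lemma bmap_of_subproof V W (f : mor V W) :
  (f : V -> W) \in bounded_linear V W.
Proof.
apply/bounded_linearP; split; first exact: mor_linear.
by exists 1 => x; rewrite mul1r mor_nonexpansive.
Qed.

Definition bmap_of V W (f : mor V W) : bmap V W := BMap (bmap_of_subproof f).

Lemma opnorm_bmap_of V W (f : mor V W) : opnorm (bmap_of f) <= 1.
Proof. by apply: opnorm_le => // x; rewrite mul1r mor_nonexpansive. Qed.

Lemma mor_of_subproof V W (f : bmap V W) : opnorm f <= 1 ->
  forall x, snorm (f x) <= snorm x.
Proof.
move=> f1 x; rewrite (le_trans (opnormP f x))// -[leRHS]mul1r.
by rewrite ler_wpM2r ?snorm_ge0.
Qed.

Definition mor_of V W (f : bmap V W) (f1 : opnorm f <= 1) : mor V W :=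
  Mor (@bmap_linear V W f) (mor_of_subproof f1).

Lemma bcomp_subproof U V W (g : bmap V W) (f : bmap U V) :
  g \o f \in bounded_linear U W.
Proof.
apply/bounded_linearP; split=> [a x y /=|]; first by rewrite !linearP.
exists (opnorm g * opnorm f) => x /=.
by rewrite (le_trans (opnormP g _))// -mulrA ler_wpM2l ?opnorm_ge0 ?opnormP.
Qed.

Definition bcomp U V W (g : bmap V W) (f : bmap U V) : bmap U W :=
  BMap (bcomp_subproof g f).

Lemma opnorm_bcomp U V W (g : bmap V W) (f : bmap U V) :
  opnorm (bcomp g f) <= opnorm g * opnorm f.
Proof.
apply: opnorm_le => [|x /=]; first by rewrite mulr_ge0 ?opnorm_ge0.
by rewrite (le_trans (opnormP g _))// -mulrA ler_wpM2l ?opnorm_ge0 ?opnormP.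
Qed.

Lemma bcompDl U V W (g h : bmap V W) (f : bmap U V) (a : K) :
  bcomp (a *: g + h) f = a *: bcomp g f + bcomp h f.
Proof. exact: bmap_eqP. Qed.

Lemma bcompDr U V W (g : bmap V W) (f h : bmap U V) (a : K) :
  bcomp g (a *: f + h) = a *: bcomp g f + bcomp g h.
Proof. by apply: bmap_eqP => x /=; exact: linearP. Qed.

(* The actions of the hom-functor on morphisms: for the V-category B of normed
   (seminormed) spaces, [hom_pre e B] is B(e, B) and [hom_post A m] is B(A, m). *)

Lemma hom_pre_linear A1 A2 (e : mor A1 A2) B :
  linear (fun g : hom A2 B => bcomp g (bmap_of e) : hom A1 B).
Proof. by move=> a g h; exact: bcompDl. Qed.

Lemma hom_pre_nonexpansive A1 A2 (e : mor A1 A2) B (g : hom A2 B) :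
  snorm (bcomp g (bmap_of e) : hom A1 B) <= snorm g.
Proof.
apply: le_trans (opnorm_bcomp _ _) _.
by rewrite -[leRHS]mulr1 ler_wpM2l ?opnorm_ge0 ?opnorm_bmap_of.
Qed.

Definition hom_pre A1 A2 (e : mor A1 A2) B : mor (hom A2 B) (hom A1 B) :=
  Mor (@hom_pre_linear A1 A2 e B) (@hom_pre_nonexpansive A1 A2 e B).

Lemma hom_post_linear A B1 B2 (m : mor B1 B2) :
  linear (fun g : hom A B1 => bcomp (bmap_of m) g : hom A B2).
Proof. by move=> a g h; exact: bcompDr. Qed.

Lemma hom_post_nonexpansive A B1 B2 (m : mor B1 B2) (g : hom A B1) :
  snorm (bcomp (bmap_of m) g : hom A B2) <= snorm g.
Proof.
apply: le_trans (opnorm_bcomp _ _) _.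
by rewrite -[leRHS]mul1r ler_wpM2r ?opnorm_ge0 ?opnorm_bmap_of.
Qed.

Definition hom_post A B1 B2 (m : mor B1 B2) : mor (hom A B1) (hom A B2) :=
  Mor (@hom_post_linear A B1 B2 m) (@hom_post_nonexpansive A B1 B2 m).

Definition morclass := forall V W, mor V W -> Prop.
Implicit Types H E M : morclass.

Definition orthogonal A1 A2 B1 B2 (e : mor A1 A2) (m : mor B1 B2) : Prop :=
  is_pullback (hom_pre e B1) (hom_post A2 m) (hom_post A1 m) (hom_pre e B2).

Definition right_orth H : morclass := fun B1 B2 m =>
  forall A1 A2 (e : mor A1 A2), H A1 A2 e -> orthogonal e m.

Definition left_orth H : morclass := fun A1 A2 e =>
  forall B1 B2 (m : mor B1 B2), H B1 B2 m -> orthogonal e m.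

Definition factors_through E M V W (f : mor V W) : Prop :=
  exists I (e : mor V I) (m : mor I W), [/\ E V I e, M I W m & f = compm m e].

Record factorization_system := FactorizationSystem {
  fs_E : morclass ;
  fs_M : morclass ;
  fs_right_orth : forall V W (f : mor V W), right_orth fs_E f <-> fs_M f ;
  fs_left_orth : forall V W (f : mor V W), left_orth fs_M f <-> fs_E f ;
  fs_factor : forall V W (f : mor V W), factors_through fs_E fs_M f
}.

(* [vm_map] is the action of T on hom-objects.  The V-functor, V-naturality and
   monad axioms are equations between morphisms out of V(V, W), V (x) W or V,
   stated here on elements, resp. pure tensors, which determine them. *)
Record vmonad := VMonad {
  vm_obj :> nspace -> nspace ;
  vm_map : forall V W, mor (hom V W) (hom (vm_obj V) (vm_obj W)) ;
  vm_map_id : forall V, vm_map V V (bmap_of (idm V)) = bmap_of (idm (vm_obj V)) ;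
  vm_map_comp : forall U V W (g : hom V W) (f : hom U V),
    vm_map U W (bcomp g f) = bcomp (vm_map V W g) (vm_map U V f) ;
  vm_unit : forall V, mor V (vm_obj V) ;
  vm_mult : forall V, mor (vm_obj (vm_obj V)) (vm_obj V) ;
  vm_unit_natural : forall V W (f : hom V W) (x : V),
    vm_unit W (bmap_fun f x) = bmap_fun (vm_map V W f) (vm_unit V x) ;
  vm_mult_natural : forall V W (f : hom V W) (x : vm_obj (vm_obj V)),
    vm_mult W (bmap_fun (vm_map _ _ (vm_map V W f)) x)
    = bmap_fun (vm_map V W f) (vm_mult V x) ;
  vm_unitl : forall V, compm (vm_mult V) (vm_unit (vm_obj V)) = idm _ ;
  vm_unitr : forall V (x : vm_obj V),
    vm_mult V (bmap_fun (vm_map _ _ (bmap_of (vm_unit V))) x) = x ;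
  vm_assoc : forall V (x : vm_obj (vm_obj (vm_obj V))),
    vm_mult V (vm_mult (vm_obj V) x)
    = vm_mult V (bmap_fun (vm_map _ _ (bmap_of (vm_mult V))) x)
}.

Lemma vm_fmap_subproof (T : vmonad) V W (f : mor V W) :
  opnorm (vm_map T V W (bmap_of f)) <= 1.
Proof.
exact: le_trans (mor_nonexpansive (vm_map T V W) (bmap_of f)) (opnorm_bmap_of f).
Qed.

(* The underlying ordinary functor of T. *)
Definition vm_fmap (T : vmonad) V W (f : mor V W) : mor (T V) (T W) :=
  mor_of (vm_fmap_subproof T f).

Section RelativeClosure.
Variables (T : vmonad) (F : factorization_system).

Definition Sigma : morclass := fun V W f => is_iso (vm_fmap T f).

Definition T_closed : morclass := fun V W m =>
  fs_M F m /\ right_orth Sigma m.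

Definition T_dense : morclass := left_orth T_closed.

Definition is_T_closure V C W (m : mor V W) (c : mor C W) : Prop :=
  T_closed c /\ exists2 e : mor V C, T_dense e & m = compm c e.

End RelativeClosure.

Definition iso_over V V' W (m : mor V W) (m' : mor V' W) : Prop :=
  exists2 i : mor V V', is_iso i & m = compm m' i.

Definition scalar_space : nspace :=
  @NSpace R k d (K^o : lmodType K) (@modulus R k) (@modulusD R k)
    (@modulusM R k) (fun=> @modulus_eq0 R k).

Definition dual V : nspace := hom V scalar_space.

Lemma dualmap_fun_linear V W (f : hom V W) :
  linear (fun phi : dual W => bcomp phi f : dual V).
Proof. by move=> a g h; exact: bcompDl. Qed.

Lemma dualmap_fun_subproof V W (f : hom V W) :
  (fun phi : dual W => bcomp phi f : dual V)
    \in bounded_linear (dual W) (dual V).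
Proof.
apply/bounded_linearP; split; first exact: dualmap_fun_linear.
by exists (opnorm f) => phi; rewrite mulrC; exact: opnorm_bcomp.
Qed.

Definition dualmap_fun V W (f : hom V W) : hom (dual W) (dual V) :=
  BMap (dualmap_fun_subproof f).

Lemma dualmap_linear V W : linear (@dualmap_fun V W).
Proof.
by move=> a f g; apply: bmap_eqP => phi; apply: bmap_eqP => x /=; exact: linearP.
Qed.

Lemma dualmap_nonexpansive V W (f : hom V W) :
  snorm (dualmap_fun f) <= snorm f.
Proof.
apply: opnorm_le => [|phi]; first exact: opnorm_ge0.
by rewrite mulrC; exact: opnorm_bcomp.
Qed.

Definition dualmap V W : mor (hom V W) (hom (dual W) (dual V)) :=
  Mor (@dualmap_linear V W) (@dualmap_nonexpansive V W).

Lemma dual_fmap_subproof V W (f : mor V W) :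
  opnorm (dualmap_fun (bmap_of f)) <= 1.
Proof. by apply: le_trans (dualmap_nonexpansive _) (opnorm_bmap_of _). Qed.

Definition dual_fmap V W (f : mor V W) : mor (dual W) (dual V) :=
  mor_of (dual_fmap_subproof f).

Lemma evalm_fun_subproof V (x : V) :
  (fun phi : dual V => bmap_fun phi x : scalar_space)
    \in bounded_linear (dual V) scalar_space.
Proof.
apply/bounded_linearP; split=> //.
by exists (snorm x) => phi; rewrite mulrC; exact: (@opnormP V scalar_space).
Qed.

Definition evalm_fun V (x : V) : dual (dual V) := BMap (evalm_fun_subproof x).

Lemma evalm_linear V : linear (@evalm_fun V).
Proof. by move=> a x y; apply: bmap_eqP => phi /=; exact: linearP. Qed.

Lemma evalm_nonexpansive V (x : V) : snorm (evalm_fun x) <= snorm x.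
Proof.
apply: opnorm_le => [|phi]; first exact: snorm_ge0.
by rewrite mulrC; exact: (@opnormP V scalar_space).
Qed.

Definition evalm V : mor V (dual (dual V)) :=
  Mor (@evalm_linear V) (@evalm_nonexpansive V).

Definition double_dual : vmonad.
Proof.
refine (@VMonad (fun V => dual (dual V))
  (fun V W => compm (dualmap (dual W) (dual V)) (dualmap V W))
  _ _ evalm (fun V => dual_fmap (evalm (dual V))) _ _ _ _ _).
- move=> V; apply: bmap_eqP => X; apply: bmap_eqP => phi /=.
  by congr (bmap_fun X); exact: bmap_eqP.
- move=> U V W g f; apply: bmap_eqP => X; apply: bmap_eqP => phi /=.
  by congr (bmap_fun X); exact: bmap_eqP.
- by move=> V W f x; apply: bmap_eqP.
- move=> V W f X; apply: bmap_eqP => phi /=; congr (bmap_fun X).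
  exact: bmap_eqP.
- by move=> V; apply: mor_eqP => X; apply: bmap_eqP.
- move=> V X; apply: bmap_eqP => phi /=; congr (bmap_fun X); exact: bmap_eqP.
- move=> V X; apply: bmap_eqP => phi /=; congr (bmap_fun X); exact: bmap_eqP.
Defined.

Record subspace W (S : submodClosed W) := Subspace {
  subspace_val :> W ;
  subspace_valP : subspace_val \in S
}.

HB.instance Definition _ W (S : submodClosed W) := [isSub for @subspace_val W S].
HB.instance Definition _ W (S : submodClosed W) := [Choice of subspace S by <:].
HB.instance Definition _ W (S : submodClosed W) :=
  [SubChoice_isSubLmodule of subspace S by <:].

Section Subspace.
Variables (W : nspace) (S : submodClosed W).
Local Notation sval := (@subspace_val W S).

Lemma subspace_normD (x y : subspace S) :
  snorm (sval (x + y)) <= snorm (sval x) + snorm (sval y).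
Proof. exact: snormD. Qed.

Lemma subspace_normZ (a : K) (x : subspace S) :
  snorm (sval (a *: x)) = modulus a * snorm (sval x).
Proof. exact: snormZ. Qed.

Lemma subspace_norm_eq0 : d = Normed ->
  forall x : subspace S, snorm (sval x) = 0 -> x = 0.
Proof. by move=> dN x x0; apply: val_inj; exact: snorm_eq0 dN _ x0. Qed.

Definition sub_nspace : nspace :=
  @NSpace R k d (subspace S) (fun x => snorm (sval x)) subspace_normD
    subspace_normZ subspace_norm_eq0.

Lemma incl_linear : linear (sval : sub_nspace -> W).
Proof. by []. Qed.

Lemma incl_nonexpansive (x : sub_nspace) : snorm (sval x) <= snorm x.
Proof. by []. Qed.

Definition sub_incl : mor sub_nspace W := Mor incl_linear incl_nonexpansive.

Definition closure_pred : {pred W} := [pred x | x \in closure [set` S]].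

Lemma closure_pred_submod : subsemimod_closed closure_pred.
Proof.
apply: GRing.submod_closed_semi; split=> [|a x y]; rewrite ?inE.
  by apply: subset_closure; exact: rpred0.
move=> /snorm_closureP xS /snorm_closureP yS; apply/snorm_closureP => e e0.
have c0 : 0 < modulus a + 1 by rewrite ltr_wpDl ?modulus_ge0.
have [|x' Sx' xx'] := xS (e / 2 / (modulus a + 1)); first by rewrite !divr_gt0.
have [|y' Sy' yy'] := yS (e / 2); first by rewrite divr_gt0.
exists (a *: x' + y'); first by rewrite /= rpredD ?rpredZ.
rewrite opprD addrACA -scalerBr [e]splitr (le_lt_trans (snormD _ _))//.
rewrite ler_ltD// snormZ; move: (ltW xx'); rewrite ler_pdivlMr// mulrC.
by apply: le_trans; rewrite ler_wpM2r ?snorm_ge0// lerDl.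
Qed.

HB.instance Definition _ :=
  GRing.isSubmodClosed.Build K W closure_pred closure_pred_submod.

Definition sub_closure : submodClosed W := closure_pred.

End Subspace.

Definition surjective_mor : morclass := fun V W f => range f = [set: W].

Definition isometric_embedding : morclass := fun V W f =>
  injective f /\ forall x, snorm (f x) = snorm x.

Definition range_pred V W (f : mor V W) : {pred W} := [pred y | y \in range f].

Lemma range_pred_submod V W (f : mor V W) : subsemimod_closed (range_pred f).
Proof.
apply: GRing.submod_closed_semi; split=> [|a x y]; rewrite ?inE.
  by exists 0 => //; exact: linear0.
by move=> [x' _ <-] [y' _ <-]; exists (a *: x' + y') => //; exact: linearP.
Qed.

HB.instance Definition _ V W (f : mor V W) :=
  GRing.isSubmodClosed.Build K W (range_pred f) (range_pred_submod f).

Lemma range_fact_subproof V W (f : mor V W) x : f x \in range_pred f.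
Proof. by rewrite inE; exists x. Qed.

Definition range_fact_fun V W (f : mor V W) (x : V) : sub_nspace (range_pred f) :=
  Subspace (range_fact_subproof f x).

Lemma range_fact_linear V W (f : mor V W) : linear (range_fact_fun f).
Proof. by move=> a x y; apply: val_inj; exact: linearP. Qed.

Definition range_fact V W (f : mor V W) : mor V (sub_nspace (range_pred f)) :=
  Mor (@range_fact_linear V W f) (mor_nonexpansive f).

Lemma range_fact_surjective V W (f : mor V W) : surjective_mor (range_fact f).
Proof.
apply/seteqP; split=> // -[y yf] _.
have /set_mem[x _ fx] : y \in range f := yf.
by exists x => //; apply: val_inj.
Qed.

Lemma incl_isometric W (S : submodClosed W) : isometric_embedding (sub_incl S).
Proof. by split=> // x y; exact: val_inj. Qed.

Lemma orthogonal_lift A1 A2 B1 B2 (e : mor A1 A2) (m : mor B1 B2)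
    (f : mor A1 B1) (g : mor A2 B2) :
  orthogonal e m -> compm m f = compm g e ->
  exists h : mor A2 B1, compm h e = f /\ compm m h = g.
Proof.
move=> [_ em] mfge.
have multP V W (l : mor V W) : exists u : mor scalar_space (hom V W),
    forall a : K, u a = a *: (bmap_of l : hom V W).
  have ul : linear (fun a : scalar_space => (a : K) *: (bmap_of l : hom V W)).
    by move=> a b c; rewrite scalerDl scalerA.
  have un (a : scalar_space) : snorm ((a : K) *: (bmap_of l : hom V W)) <= snorm a.
    rewrite snormZ -[leRHS]mulr1 ler_wpM2l ?modulus_ge0//.
    exact: opnorm_bmap_of.
  by exists (Mor ul un).
have [u uE] := multP _ _ f; have [v vE] := multP _ _ g.
have [|h [[hu hv] _]] := em _ u v.
  apply: mor_eqP => a; apply: bmap_eqP => x /=; rewrite uE vE !bmapZ linearZ.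
  by congr (_ *: _); exact: (congr1 (fun w : mor _ _ => w x) mfge).
have h1 : opnorm (h (1 : K)) <= 1.
  by rewrite (le_trans (mor_nonexpansive h _))// -[leRHS](@modulus1 R k).
exists (mor_of h1); split; apply: mor_eqP => x /=.
- have := congr1 (fun w : mor scalar_space (hom A1 B1) => bmap_fun (w (1 : K)) x) hu.
  by rewrite /= uE bmapZ scale1r.
- have := congr1 (fun w : mor scalar_space (hom A2 B2) => bmap_fun (w (1 : K)) x) hv.
  by rewrite /= vE bmapZ scale1r.
Qed.

Lemma isometric_orthogonal A1 A2 B1 B2 (e : mor A1 A2) (m : mor B1 B2) :
  isometric_embedding m ->
  (forall (u : hom A1 B1) (v : hom A2 B2), (forall x, m (u x) = v (e x)) ->
    forall y, exists b, m b = v y) ->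
  orthogonal e m.
Proof.
move=> [mI mN] lift; split=> [|Q u v uv]; first by apply: mor_eqP => g; exact: bmap_eqP.
have uvE q x : m (bmap_fun (u q) x) = bmap_fun (v q) (e x).
  exact: (congr1 (fun w : mor Q (hom A1 B2) => bmap_fun (w q) x) uv).
have /choice[H HE] : forall qy : Q * A2, exists b, m b = bmap_fun (v qy.1) qy.2.
  by move=> [q y]; exact: lift (uvE q) y.
have Hbd q : (fun y => H (q, y)) \in bounded_linear A2 B1.
  apply/bounded_linearP; split=> [a x y|].
    by apply: mI; rewrite linearP /= !HE /= linearP.
  by exists (opnorm (v q)) => y; rewrite -mN HE; exact: opnormP.
pose h q : hom A2 B1 := BMap (Hbd q).
have hl : linear h.
  move=> a p q; apply: bmap_eqP => y; apply: mI.
  by rewrite bmapD bmapZ linearP /= !HE /= linearP.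
have hn q : snorm (h q) <= snorm q.
  apply: le_trans (mor_nonexpansive v q).
  apply: opnorm_le => [|y]; first exact: opnorm_ge0.
  by rewrite -mN /= HE; exact: opnormP.
exists (Mor hl hn); split=> [|h' [_ h'v]].
  split; apply: mor_eqP => q; apply: bmap_eqP => x /=; last by rewrite HE.
  by apply: mI; rewrite HE uvE.
apply: mor_eqP => q; apply: bmap_eqP => y; apply: mI; rewrite /= HE.
by rewrite -h'v.
Qed.

Lemma surjective_orthogonal_isometric A1 A2 B1 B2
    (e : mor A1 A2) (m : mor B1 B2) :
  surjective_mor e -> isometric_embedding m -> orthogonal e m.
Proof.
move=> eS mM; apply: isometric_orthogonal => // u v uv y.
have [x _ <-] : range e y by rewrite eS.
by exists (u x).
Qed.

Lemma right_orth_surjective V W (f : mor V W) :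
  right_orth surjective_mor f <-> isometric_embedding f.
Proof.
split=> [fR|fM A1 A2 e eS]; last exact: surjective_orthogonal_isometric.
have [|h [he _]] := @orthogonal_lift _ _ _ _ _ _ (idm V) (sub_incl (range_pred f))
  (fR _ _ _ (range_fact_surjective f)); first exact: mor_eqP.
have hE x : h (range_fact f x) = x.
  exact: (congr1 (fun w : mor _ _ => w x) he).
split=> [x y fxy|x].
  by rewrite -[x]hE -[y]hE; congr (h _); exact: val_inj.
apply/le_anti; rewrite mor_nonexpansive -[in leLHS](hE x).
exact: (mor_nonexpansive h).
Qed.

Lemma left_orth_isometric V W (f : mor V W) :
  left_orth isometric_embedding f <-> surjective_mor f.
Proof.
split=> [fL|fS B1 B2 m mM]; last exact: surjective_orthogonal_isometric.
have [|h [_ hi]] := @orthogonal_lift _ _ _ _ _ _ (range_fact f) (idm W)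
  (fL _ _ _ (incl_isometric (range_pred f))); first exact: mor_eqP.
apply/seteqP; split=> // y _.
have /set_mem : subspace_val (h y) \in range f := subspace_valP (h y).
by rewrite (congr1 (fun w : mor _ _ => w y) hi : subspace_val (h y) = y).
Qed.

Lemma surj_isom_factor V W (f : mor V W) :
  factors_through surjective_mor isometric_embedding f.
Proof.
exists (sub_nspace (range_pred f)), (range_fact f), (sub_incl (range_pred f)).
split; [exact: range_fact_surjective|exact: incl_isometric|exact: mor_eqP].
Qed.

Definition surj_isom : factorization_system :=
  FactorizationSystem right_orth_surjective left_orth_isometric surj_isom_factor.

End Category.

(* Main.v *)
Require Import Defs.
From HB Require Import structures.
From mathcomp Require Import all_boot all_order all_algebra.
From mathcomp Require Import boolp classical_sets functions reals topology.
From mathcomp Require Import complex lra.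

Set Implicit Arguments.
Unset Strict Implicit.
Unset Printing Implicit Defensive.
Import Order.TTheory GRing.Theory Num.Theory.
Local Open Scope classical_set_scope.
Local Open Scope ring_scope.

(** Write [e] for a morphism inverted by the double dual.  Everything follows
    from two relations between such morphisms and density.

    First, [e] has dense range ([Sigma_dense]).  If a point [y] were at positive
    distance from the range, the Hahn-Banach theorem would give a functional
    [phi] that kills the range but not [y]; every bidual element of the form
    [X \o e^*] vanishes at [phi], so evaluation at [y] would not be in the image
    of [e^**].

    Secondly, a dense isometric embedding is inverted already by the dual
    ([dense_isometric_dual_iso]): restriction of functionals along it is
    injective by density, and surjective and norm preserving because functionals
    extend without increase of norm.  Injectivity holds even between seminormed
    spaces, because the scalars, where functionals take their values, are
    separated.

    Closed isometric embeddings are orthogonal to all dense morphisms: a map that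
    sends a dense subspace into a closed one sends everything there.  So they are
    T-closed.  Conversely, a T-closed embedding [m] is orthogonal to the inclusion
    of its range in the closure of the range, which is a dense isometric
    embedding; the resulting lift shows that the range was closed.  Every morphism
    factors through the closure of its range, as a dense morphism followed by a
    closed embedding; hence a T-dense [f] lifts the identity of its codomain into
    this closure, and is dense.  The closure of a subspace is one such
    factorization, and orthogonality makes any two isomorphic.

    The Hahn-Banach theorem is needed over both scalar fields and for extension
    as well as separation.  Both come from one statement about real functionals,
    the Mazur-Orlicz theorem ([mazur_orlicz]): a linear functional below a
    sublinear [q] can be chosen to respect prescribed upper bounds on a convex
    cone, as soon as [q] does not contradict these bounds.  It is proved without
    partially defined functionals: Zorn's lemma gives a minimal sublinear
    functional, and a minimal one is linear. *)

(** * Real and complex scalars as a real normed space *)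

Section RealStructure.
Context {R : realType} {k : scalar_kind}.

Definition real_scalar : R -> scalars R k :=
  match k return R -> scalars R k with
  | RealScalars => fun t => t
  | ComplexScalars => fun t => Complex t 0
  end.

Definition real_part : scalars R k -> R :=
  match k return scalars R k -> R with
  | RealScalars => fun z => z
  | ComplexScalars => fun z : complex R => complex.Re z
  end.

Lemma real_scalar0 : real_scalar 0 = 0.
Proof. by rewrite /real_scalar; case: k. Qed.

Lemma real_scalar1 : real_scalar 1 = 1.
Proof. by rewrite /real_scalar; case: k. Qed.

Lemma real_scalarD s t : real_scalar (s + t) = real_scalar s + real_scalar t.
Proof.
by rewrite /real_scalar; case: k => //=; congr Complex; rewrite addr0.
Qed.

Lemma real_scalarN t : real_scalar (- t) = - real_scalar t.
Proof.
by rewrite /real_scalar; case: k => //=; congr Complex; rewrite oppr0.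
Qed.

Lemma real_scalarM s t : real_scalar (s * t) = real_scalar s * real_scalar t.
Proof.
rewrite /real_scalar; case: k => //=; congr Complex.
  by rewrite mulr0 subr0.
by rewrite mulr0 mul0r addr0.
Qed.

Lemma modulus_real_scalar t : 0 <= t -> modulus (real_scalar t) = t.
Proof.
rewrite /modulus /real_scalar; case: k => t0; first exact: ger0_norm.
by rewrite /= expr0n addr0 sqrtr_sqr ger0_norm.
Qed.

Lemma real_partD z w : real_part (z + w) = real_part z + real_part w.
Proof. by rewrite /real_part; case: k z w => //= -[a b] [c e]. Qed.

Lemma real_part0 : real_part 0 = 0.
Proof. by rewrite /real_part; case: k. Qed.

Lemma real_partN z : real_part (- z) = - real_part z.
Proof. by rewrite /real_part; case: k z => //= -[a b]. Qed.

Lemma real_partZ t z : real_part (real_scalar t * z) = t * real_part z.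
Proof.
rewrite /real_part /real_scalar; case: k z => //= -[a b].
by rewrite /= mul0r subr0.
Qed.

Lemma real_part_le z : real_part z <= modulus z.
Proof.
rewrite /real_part /modulus; case: k z => [z|[a b]] /=; first exact: ler_norm.
apply: le_trans (ler_norm a) _.
by rewrite -sqrtr_sqr ler_wsqrtr// lerDl sqr_ge0.
Qed.

(** The witness is the conjugate of [z]. *)
Lemma polar_multiplier z :
  exists2 w, modulus w = modulus z & real_part (w * z) = modulus z ^+ 2.
Proof.
rewrite /real_part /modulus; case: k z => [z|[a b]].
  by exists z => //; rewrite real_normK ?num_real// expr2.
exists (Complex a (- b)); first by rewrite /= sqrrN.
by rewrite /= mulNr opprK -!expr2 sqr_sqrtr// addr_ge0 ?sqr_ge0.
Qed.

Lemma real_part_mul_eq0 z : (forall w, real_part (w * z) = 0) -> z = 0.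
Proof.
have [w _ wz] := polar_multiplier z => /(_ w) /esym/eqP.
by rewrite wz eq_sym sqrf_eq0 => /eqP /modulus_eq0.
Qed.

End RealStructure.

(** Over the complex numbers the functional is forced by its real part to be
    [f x - i f (i x)]. *)
Lemma real_linear_complexify (R : realType) (k : scalar_kind)
    (W : lmodType (scalars R k)) (f : W -> R) :
  (forall x y, f (x + y) = f x + f y) ->
  (forall t x, f (real_scalar t *: x) = t * f x) ->
  exists2 psi : W -> (scalars R k)^o, linear psi &
    forall x, real_part (psi x : scalars R k) = f x.
Proof.
case: k W f => W f fD fZ; first by exists f => // a x y; rewrite fD fZ.
pose i : scalars R ComplexScalars := Complex 0 1.
exists (fun x => Complex (f x) (- f (i *: x)) : complex R) => // -[a b] x y.
have zE (z : W) : (Complex a b : scalars R ComplexScalars) *: z =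
    real_scalar a *: z + real_scalar b *: (i *: z).
  rewrite scalerA -scalerDl; congr (_ *: _); rewrite /real_scalar /=.
  by congr Complex; rewrite ?mulr0 ?mul0r ?mulr1 ?subr0 ?addr0 ?add0r.
have iiE z : i *: (i *: z) = real_scalar (-1) *: z.
  rewrite scalerA; congr (_ *: _); rewrite /real_scalar /=.
  by congr Complex; rewrite ?mulr0 ?mul0r ?mulr1 ?addr0 ?add0r.
have ir (t : R) z : i *: (real_scalar t *: z) = real_scalar t *: (i *: z).
  by rewrite !scalerA mulrC.
rewrite zE !scalerDr !ir iiE !fD !fZ.
by congr Complex; lra.
Qed.

(** * Sublinear functionals and the Mazur-Orlicz theorem *)

Section Sublinear.
Context {R : realType} {k : scalar_kind} {W : lmodType (scalars R k)}.
Implicit Types (q : W -> R) (G : set (W * R)).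

(** Homogeneity is an inequality so that it passes to infima directly; equality
    follows by applying it to the inverse of [t]. *)
Definition sublinear q :=
  (forall x y, q (x + y) <= q x + q y) /\
  (forall t x, 0 < t -> q (real_scalar t *: x) <= t * q x).

Lemma sublinearZ q t x : sublinear q -> 0 < t ->
  q (real_scalar t *: x) = t * q x.
Proof.
move=> [_ qZ] t0; apply/le_anti; rewrite qZ//=.
have ti : 0 < t^-1 by rewrite invr_gt0.
have := qZ _ (real_scalar t *: x) ti.
rewrite scalerA -real_scalarM mulVf ?gt_eqF// real_scalar1 scale1r.
by rewrite mulrC ler_pdivlMr// mulrC.
Qed.

Lemma sublinear0 q : sublinear q -> q 0 = 0.
Proof.
move=> qS; have := sublinearZ 0 qS (ltr0Sn R 1); rewrite scaler0; lra.
Qed.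

Lemma sublinear_ge q x : sublinear q -> - q (- x) <= q x.
Proof.
by move=> qS; have := qS.1 x (- x); rewrite subrr (sublinear0 qS); lra.
Qed.

(** A pair [(a, c)] in the cone stands for the constraint [f a <= c] on a
    functional [f]. *)
Definition convex_cone G :=
  [/\ G (0, 0),
      forall a b, G a -> G b -> G (a.1 + b.1, a.2 + b.2) &
      forall t a, 0 < t -> G a -> G (real_scalar t *: a.1, t * a.2)].

(** The infimal convolution of [q] with the cone: the largest value at [x] that
    the bound [q] and the constraints in [G] allow to a linear functional. *)
Definition cone_conv q G (x : W) : R :=
  inf [set r | exists2 a, G a & r = q (x - a.1) + a.2].

Section ConeConv.
Variables (q : W -> R) (G : set (W * R)).
Hypotheses (qS : sublinear q) (GC : convex_cone G).
(* Together with a linear [f] below [q], the constraint [f a <= c] gives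
   [- c <= f (- a) <= q (- a)]; so this is the least that can be asked. *)
Hypothesis Gq : forall a, G a -> - a.2 <= q (- a.1).

Let lower x :
  lbound [set r | exists2 a, G a & r = q (x - a.1) + a.2] (- q (- x)).
Proof.
move=> _ [a /Gq aq ->].
have := qS.1 (x - a.1) (- x); rewrite addrAC subrr add0r; lra.
Qed.

Let conv_has_inf x : has_inf [set r | exists2 a, G a & r = q (x - a.1) + a.2].
Proof.
split; last by exists (- q (- x)); exact: lower.
by exists (q (x - 0) + 0), (0, 0) => //; case: GC.
Qed.

Lemma cone_conv_le a x : G a -> cone_conv q G x <= q (x - a.1) + a.2.
Proof. by move=> Ga; apply: ge_inf; [case: (conv_has_inf x)|exists a]. Qed.

Let cone_conv_approx x e : 0 < e ->
  exists2 a, G a & q (x - a.1) + a.2 < cone_conv q G x + e.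
Proof.
by move=> e0; have [_ [a Ga ->]] := inf_adherent e0 (conv_has_inf x); exists a.
Qed.

Lemma cone_conv_sublinear : sublinear (cone_conv q G).
Proof.
have [G0 GD GZ] := GC; split=> [x y|t x t0]; apply/ler_addgt0Pr => e e0.
  have e20 : 0 < e / 2 by lra.
  have [a Ga ax] := cone_conv_approx x e20.
  have [b Gb bx] := cone_conv_approx y e20.
  have := cone_conv_le (x + y) (GD _ _ Ga Gb); rewrite /= opprD addrACA.
  have := qS.1 (x - a.1) (y - b.1); lra.
have [a Ga ax] := cone_conv_approx x (divr_gt0 e0 t0).
have := cone_conv_le (real_scalar t *: x) (GZ _ _ t0 Ga).
rewrite /= -scalerBr (sublinearZ _ qS t0) -mulrDr => /le_trans; apply.
have := ltW ax; rewrite -(ler_pM2l t0) => /le_trans; apply.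
by rewrite mulrDr mulrCA divff ?gt_eqF// mulr1.
Qed.

Lemma cone_conv_le_sublinear x : cone_conv q G x <= q x.
Proof. by case: GC => /(cone_conv_le x); rewrite /= subr0 addr0. Qed.

End ConeConv.

(** Convolving [q] with the ray of constraints [f (- t x) <= - t q x] yields a
    sublinear functional below [q] that also obeys [f (- x) <= - q x].  By
    minimality [q] itself obeys it, and the opposite inequality always holds. *)
Lemma minimal_sublinear_odd q : sublinear q ->
  (forall g, sublinear g -> (forall x, g x <= q x) -> g = q) ->
  forall x, q (- x) = - q x.
Proof.
move=> qS qmin x; pose G := [set a : W * R | exists2 t, 0 <= t &
  a = (real_scalar t *: - x, - (t * q x))].
have qZ t : 0 <= t -> q (real_scalar t *: x) = t * q x.
  rewrite le_eqVlt => /predU1P[<-|]; last exact: sublinearZ.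
  by rewrite real_scalar0 scale0r mul0r sublinear0.
have GC : convex_cone G.
  split=> [|_ _ [s s0 ->] [t t0 ->]|s _ s0 [t t0 ->]].
  - by exists 0; rewrite // real_scalar0 scale0r mul0r oppr0.
  - by exists (s + t); rewrite ?addr_ge0//= real_scalarD scalerDl mulrDl opprD.
  - exists (s * t); first by rewrite mulr_ge0// ltW.
    by rewrite /= real_scalarM scalerA mulrN mulrA.
have Gq a : G a -> - a.2 <= q (- a.1).
  by move=> [t t0 ->] /=; rewrite scalerN !opprK qZ.
have gq := qmin _ (cone_conv_sublinear qS GC Gq)
  (cone_conv_le_sublinear qS GC Gq).
have G1 : G (- x, - q x).
  by exists 1; rewrite ?ler01// real_scalar1 scale1r mul1r.
have := cone_conv_le qS GC Gq (- x) G1.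
rewrite gq /= subrr sublinear0// add0r => le1.
by have := sublinear_ge x qS; lra.
Qed.

(** The pointwise infimum of a chain of sublinear functionals is subadditive
    because any two members of the chain are comparable, so that the smaller one
    bounds the value at a sum; it is finite because all members are at least
    [- p (- x)]. *)
Lemma minimal_sublinear p : sublinear p -> exists q,
  [/\ sublinear q, forall x, q x <= p x &
      forall g, sublinear g -> (forall x, g x <= q x) -> g = q].
Proof.
move=> pS; pose T := {q : W -> R | sublinear q /\ forall x, q x <= p x}.
pose le (r s : T) := `[< forall x, sval s x <= sval r x >].
have [||||[q [qS qp]] qmax] := @Zorn T le.
- by move=> t; apply/asboolP.
- move=> r s t /asboolP rs /asboolP st; apply/asboolP => x.
  exact: le_trans (st x) (rs x).
- move=> [r r'] [s s'] /asboolP /= rs /asboolP /= sr; apply: eq_exist => /=.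
  by apply/funext => x; apply/le_anti; rewrite rs sr.
- move=> A Atot; have [->|/set0P[a0 Aa0]] := eqVneq A set0.
    by exists (exist _ p (conj pS (fun x => lexx _))).
  pose B x := [set sval a x | a in A].
  have Binf x : has_inf (B x).
    split; first by exists (sval a0 x), a0.
    exists (- p (- x)) => _ [[r [rS rp]] _ <-] /=.
    by have := sublinear_ge x rS; have := rp (- x); lra.
  pose g x := inf (B x).
  have gle a x : A a -> g x <= sval a x.
    by move=> Aa; apply: ge_inf; [case: (Binf x)|exists a].
  have gadh x e : 0 < e -> exists2 a, A a & sval a x < g x + e.
    by move=> e0; have [_ [a Aa <-] ?] := inf_adherent e0 (Binf x); exists a.
  have gS : sublinear g.
    split=> [x y|t x t0]; apply/ler_addgt0Pr => e e0.
      have e20 : 0 < e / 2 by lra.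
      have [a Aa ax] := gadh x _ e20; have [b Ab bx] := gadh y _ e20.
      have [/asboolP ab|/asboolP ab] := Atot _ _ Aa Ab.
        have := gle _ (x + y) Ab; have := (svalP b).1.1 x y.
        by have := ab x; lra.
      have := gle _ (x + y) Aa; have := (svalP a).1.1 x y.
      by have := ab y; lra.
    have [a Aa ax] := gadh x _ (divr_gt0 e0 t0).
    apply: le_trans (gle _ _ Aa) _; apply: le_trans ((svalP a).1.2 _ _ t0) _.
    have := ltW ax; rewrite -(ler_pM2l t0) mulrDr => /le_trans; apply.
    by rewrite mulrCA divff ?gt_eqF// mulr1.
  have gp x : g x <= p x by apply: le_trans (gle a0 x Aa0) ((svalP a0).2 x).
  by exists (exist _ g (conj gS gp)) => a Aa; apply/asboolP => x; exact: gle.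
exists q; split=> // g gS gq.
have gp x : g x <= p x := le_trans (gq x) (qp x).
have := qmax (exist _ g (conj gS gp)) => /(_ _)/(congr1 sval) /= -> //.
exact/asboolP.
Qed.

(** A minimal sublinear functional below the convolution is odd, and an odd
    sublinear functional is linear. *)
Lemma mazur_orlicz q G : sublinear q -> convex_cone G ->
  (forall a, G a -> - a.2 <= q (- a.1)) ->
  exists f : W -> R,
    [/\ forall x y, f (x + y) = f x + f y,
        forall t x, f (real_scalar t *: x) = t * f x,
        forall x, f x <= q x & forall a, G a -> f a.1 <= a.2].
Proof.
move=> qS GC Gq; have gS := cone_conv_sublinear qS GC Gq.
have [f [fS fg fmin]] := minimal_sublinear gS.
have fN := minimal_sublinear_odd fS fmin.
exists f; split=> [x y|t x|x|a Ga].
- apply/le_anti; rewrite fS.1 /=.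
  by have := fS.1 (- x) (- y); rewrite -opprD !fN; lra.
- have [t0|t0|->] := ltgtP t 0; last 1 first.
  + by rewrite real_scalar0 scale0r mul0r sublinear0.
  + rewrite -[t in LHS]opprK real_scalarN scaleNr fN sublinearZ ?oppr_gt0//.
    by rewrite mulNr opprK.
  + exact: sublinearZ.
- exact: le_trans (fg x) (cone_conv_le_sublinear qS GC Gq x).
- apply: le_trans (fg _) _; apply: le_trans (cone_conv_le qS GC Gq _ Ga) _.
  by rewrite subrr sublinear0// add0r.
Qed.

End Sublinear.

(** * The Hahn-Banach theorem for seminormed spaces *)

Section HahnBanach.
Context {R : realType} {k : scalar_kind} {d : norm_kind}.
Local Notation K := (scalars R k).
Implicit Types V W : nspace R k d.

(** One-sided bounds on the real part suffice, since the domain is stable under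
    all scalars: negation gives equality, multiplication by a suitable scalar
    then gives the whole value. *)
Lemma linear_real_part_le0 V (g : V -> K^o) : linear g ->
  (forall x, real_part (g x : K) <= 0) -> forall x, g x = 0.
Proof.
move=> gl g0 x; apply: real_part_mul_eq0 => w.
have gD y z : g (y + z) = g y + g z by have := gl 1 y z; rewrite !scale1r.
have g00 : g 0 = 0 by apply: (addrI (g 0)); rewrite -gD !addr0.
have gZ y : g (w *: y) = w * g y.
  by have := gl w y 0; rewrite g00 !addr0.
have := g0 (w *: x); have := g0 (- (w *: x)).
have -> : g (- (w *: x)) = - g (w *: x).
  by apply: (addrI (g (w *: x))); rewrite -gD !subrr.
rewrite gZ (real_partN (w * g x)); lra.
Qed.

(** The common source of extension and separation.  The modulus of the
    functional is controlled by its real part, because each value becomes real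
    and nonnegative after multiplication by a scalar, which can be absorbed in
    the argument. *)
Lemma hahn_banach_cone V (G : set (V * R)) (C : R) : 0 <= C ->
  convex_cone G -> (forall a, G a -> - a.2 <= C * snorm a.1) ->
  exists psi : dual V, snorm psi <= C /\
    forall a, G a -> real_part (bmap_fun psi a.1 : K) <= a.2.
Proof.
move=> C0 GC GB; pose q (x : V) := C * snorm x.
have qS : sublinear q.
  split=> [x y|t x t0]; first by rewrite -mulrDr ler_wpM2l// snormD.
  by rewrite /q snormZ (modulus_real_scalar (ltW t0)) mulrCA.
have [|f [fD fZ fq fG]] := mazur_orlicz qS GC.
  by move=> a /GB; rewrite /q snormN.
have [psi psil psiE] := real_linear_complexify fD fZ.
have psiC (x : V) : modulus (psi x : K) <= C * snorm x.
  have [->|psi0] := eqVneq (modulus (psi x : K)) 0.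
    by rewrite mulr_ge0 ?snorm_ge0.
  have m0 : 0 < modulus (psi x : K) by rewrite lt_def psi0 modulus_ge0.
  have [w wm wE] := polar_multiplier (psi x : K).
  have psi00 : psi 0 = 0.
    have := psil 1 0 0; rewrite !scale1r addr0 => /eqP.
    by rewrite -subr_eq0 opprD addrA subrr sub0r oppr_eq0 => /eqP.
  have psiZ : psi (w *: x) = w * (psi x : K).
    by have := psil w x 0; rewrite psi00 !addr0.
  have := fq (w *: x); rewrite -psiE psiZ wE /q snormZ wm mulrCA expr2.
  by rewrite ler_pM2l.
have psib : psi \in @bounded_linear R k d V scalar_space.
  by apply/bounded_linearP; split=> //; exists C.
exists (BMap psib); split=> [|a Ga /=]; first exact: opnorm_le.
by rewrite psiE; exact: fG.
Qed.

(** The cone is the graph of the real part of [phi] along [e]. *)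
Lemma hahn_banach_extension V W (e : mor V W) (phi : dual V) :
  (forall x, snorm (e x) = snorm x) ->
  exists2 psi : dual W, snorm psi <= snorm phi &
    forall x, bmap_fun psi (e x) = bmap_fun phi x.
Proof.
move=> eN.
pose G := [set (e x, real_part (bmap_fun phi x : K)) | x in [set: V]].
have GC : convex_cone G.
  split=> [|_ _ [x _ <-] [y _ <-]|t _ t0 [x _ <-]].
  - by exists 0; rewrite // !linear0 real_part0.
  - by exists (x + y); rewrite // !linearD real_partD.
  - by exists (real_scalar t *: x); rewrite // !linearZ /= real_partZ.
have [|||psi [psin psiG]] := @hahn_banach_cone W G (snorm phi) => //.
- exact: snorm_ge0.
- move=> _ [x _ <-] /=; rewrite eN -real_partN.
  apply: le_trans (real_part_le _) _.
  have <- : bmap_fun phi (- x) = - (bmap_fun phi x : K) by exact: linearN.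
  by rewrite -[snorm x]snormN; apply: (@opnormP _ _ _ V scalar_space).
exists psi => // x; apply/eqP; rewrite -subr_eq0; apply/eqP; move: x.
apply: linear_real_part_le0 => [a x y|x].
  by rewrite !linearP /= scalerDr addrACA.
have Gx : G (e x, real_part (bmap_fun phi x : K)) by exists x.
rewrite (real_partD (bmap_fun psi (e x) : K)) real_partN subr_le0.
exact: psiG Gx.
Qed.

(** If [r] is a lower bound for the distance from [y] to the range, the
    constraints [f (e x - t y) <= - t r] are compatible with the seminorm; they
    force [f] to vanish on the range and to be at least [r] at [y]. *)
Lemma hahn_banach_separation V W (e : mor V W) (y : W) :
  ~ closure (range e) y ->
  exists2 psi : dual W, forall x, bmap_fun psi (e x) = 0 &
    bmap_fun psi y <> 0.
Proof.
move=> /snorm_closureP/existsNP[r /not_implyP[r0 ry]].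
have yr x : r <= snorm (y - e x).
  by rewrite leNgt; apply/negP => xy; apply: ry; exists (e x) => //; exists x.
pose G := [set a : W * R | exists x, exists2 t : R, 0 <= t &
  a = (e x - real_scalar t *: y, - (t * r))].
have GC : convex_cone G.
  split=> [|_ _ [x [s s0 ->]] [x' [t t0 ->]]|s _ s0 [x [t t0 ->]]].
  - exists 0, 0 => //.
    by rewrite linear0 real_scalar0 scale0r mul0r subrr oppr0.
  - exists (x + x'), (s + t); first by rewrite addr_ge0.
    by rewrite /= linearD real_scalarD scalerDl mulrDl !opprD addrACA.
  - exists (real_scalar s *: x), (s * t); first by rewrite mulr_ge0 ?(ltW s0).
    rewrite /= [e (_ *: _)]linearZ scalerBr scalerA -real_scalarM mulrN.
    by rewrite mulrA.
have [|||psi [_ psiG]] := @hahn_banach_cone W G 1 => //.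
  move=> _ [x [t t0 ->]] /=; rewrite opprK mul1r.
  move: t0; rewrite le_eqVlt => /predU1P[<-|t0].
    by rewrite mul0r snorm_ge0.
  have -> : e x - real_scalar t *: y =
      - (real_scalar t *: (y - e (real_scalar t^-1 *: x))).
    rewrite [e (_ *: _)]linearZ /= scalerBr scalerA -real_scalarM.
    by rewrite divff ?gt_eqF// real_scalar1 scale1r opprB.
  by rewrite snormN snormZ (modulus_real_scalar (ltW t0)) ler_pM2l.
exists psi => [|y0].
  apply: (@linear_real_part_le0 V) => [a x x'|x]; first by rewrite !linearP.
  suff /psiG : G (e x, 0) by [].
  by exists x, 0; rewrite // real_scalar0 scale0r mul0r subr0 oppr0.
have /psiG /= : G (- y, - r).
  by exists 0, 1; rewrite ?ler01// linear0 sub0r real_scalar1 scale1r mul1r.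
have -> : bmap_fun psi (- y) = - bmap_fun psi y by exact: linearN.
by rewrite y0 oppr0 real_part0; lra.
Qed.

End HahnBanach.

(** * Density and the double dual *)

Lemma denseP (T : topologicalType) (A : set T) :
  dense A <-> forall x, closure A x.
Proof.
split=> [dA x B|clA O [x Ox] oO].
  rewrite nbhsE => -[U [oU Ux] UB].
  have [|y [Uy Ay]] := dA U _ oU; first by exists x.
  by exists y; split=> //; exact: UB.
by rewrite setIC; apply: (clA x); exact: open_nbhs_nbhs.
Qed.

Section DoubleDualDensity.
Context {R : realType} {k : scalar_kind} {d : norm_kind}.
Local Notation K := (scalars R k).
Local Notation nspace := (nspace R k d).
Local Notation T := (@double_dual R k d).
Local Notation F := (@surj_isom R k d).
Implicit Types U V W : nspace.

Lemma bmap_closure V W (f : bmap V W) (A : set V) (x : V) :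
  closure A x -> closure (f @` A) (f x).
Proof.
move=> /snorm_closureP Ax; apply/snorm_closureP => r r0.
have C0 : 0 < opnorm f + 1 by rewrite ltr_wpDl ?opnorm_ge0.
have [y Ay xy] := Ax _ (divr_gt0 r0 C0).
exists (f y); first by exists y.
rewrite -linearB; apply: le_lt_trans (opnormP f _) _.
apply: (@le_lt_trans _ _ ((opnorm f + 1) * snorm (x - y))).
  by rewrite ler_wpM2r ?snorm_ge0// lerDl.
by rewrite mulrC -ltr_pdivlMr.
Qed.

(** Continuity, together with the fact that the scalars are separated even when
    the space is only seminormed. *)
Lemma functional_closure_eq0 V (phi : dual V) (A : set V) :
  (forall x, A x -> bmap_fun phi x = 0) ->
  forall x, closure A x -> bmap_fun phi x = 0.
Proof.
move=> phiA x /(@bmap_closure V scalar_space phi A x) /snorm_closureP phix.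
apply: modulus_eq0; apply/le_anti; rewrite modulus_ge0 andbT.
apply/ler_addgt0Pr => r r0; rewrite add0r.
have [_ [y Ay <-]] := phix r r0.
by rewrite (phiA _ Ay) subr0 => /ltW.
Qed.

Lemma isometric_bijective_iso V W (f : mor V W) :
  isometric_embedding f -> surjective_mor f -> is_iso f.
Proof.
move=> [fI fN] fS.
have /choice[g fg] : forall y, exists x, f x = y.
  move=> y; have [x _ <-] : range f y by rewrite fS.
  by exists x.
have gl : linear g by move=> a x y; apply: fI; rewrite fg linearP /= !fg.
have gn y : snorm (g y) <= snorm y by rewrite -fN fg.
exists (Mor gl gn); split; apply: mor_eqP => x /=; last exact: fg.
by apply: fI; rewrite fg.
Qed.

Lemma dual_fmap_iso V W (f : mor V W) : is_iso f -> is_iso (dual_fmap f).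
Proof.
move=> [g [gf fg]]; exists (dual_fmap g).
split; apply: mor_eqP => phi; apply: bmap_eqP => x /=; congr (bmap_fun phi _).
  exact: (congr1 (fun h : mor W W => h x) fg).
exact: (congr1 (fun h : mor V V => h x) gf).
Qed.

(** Restriction along [e] is injective on functionals by density.  Hence the
    norm-preserving extension of a restriction of [psi] is [psi] itself, which
    shows that restriction does not decrease norms. *)
Lemma dense_isometric_dual_iso V W (e : mor V W) :
  isometric_embedding e -> dense (range e) -> is_iso (dual_fmap e).
Proof.
move=> [_ eN] /denseP eD.
have inj : injective (dual_fmap e).
  move=> phi psi ephi; apply/eqP; rewrite -subr_eq0; apply/eqP.
  apply: bmap_eqP => y; move: (eD y); apply: functional_closure_eq0.
  move=> _ [x _ <-].
  have := congr1 (fun chi : dual V => bmap_fun chi x) ephi => /= ephix.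
  rewrite [LHS](_ : _ = bmap_fun phi (e x) - bmap_fun psi (e x))//.
  by rewrite ephix subrr.
have ext (phi : dual V) : exists2 psi, snorm psi <= snorm phi &
    dual_fmap e psi = phi.
  have [psi psin psiE] := hahn_banach_extension phi eN.
  by exists psi => //; apply: bmap_eqP => x; exact: psiE.
apply: isometric_bijective_iso; first split=> // psi.
  apply/le_anti; rewrite mor_nonexpansive /=.
  by have [chi + /inj E] := ext (dual_fmap e psi); rewrite E.
by apply/seteqP; split=> // phi _; have [psi _ <-] := ext phi; exists psi.
Qed.

Lemma dense_isometric_Sigma V W (e : mor V W) :
  isometric_embedding e -> dense (range e) -> Sigma T e.
Proof.
move=> eM eD; rewrite /Sigma.
have -> : vm_fmap T e = dual_fmap (dual_fmap e).
  by apply: mor_eqP => X; apply: bmap_eqP => phi /=; congr (bmap_fun X _);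
    exact: bmap_eqP.
by apply: dual_fmap_iso; exact: dense_isometric_dual_iso.
Qed.

(** Otherwise the bidual map is not surjective: evaluation at a point [y] off the
    closure of the range is not in its image, as a functional separating [y] from
    the range shows. *)
Lemma Sigma_dense V W (e : mor V W) : Sigma T e -> dense (range e).
Proof.
move=> [g [_ eg]]; apply/denseP => y; apply: contrapT.
move=> /hahn_banach_separation[phi phie]; apply.
have := congr1 (fun h : mor (dual (dual W)) (dual (dual W)) =>
  bmap_fun (h (evalm W y)) phi) eg => /= <-.
have -> : bcomp phi (bmap_of e) = 0 by apply: bmap_eqP => x; exact: phie.
exact: linear0.
Qed.

(** By continuity, a bounded map that sends the dense range of [e] into the
    closed range of [m] sends the whole space there. *)
Lemma dense_orthogonal_closed (A1 A2 B1 B2 : nspace)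
    (e : mor A1 A2) (m : mor B1 B2) :
  dense (range e) -> isometric_embedding m -> closed (range m) ->
  Defs.orthogonal e m.
Proof.
move=> /denseP eD mM mC; apply: isometric_orthogonal => // u v uv y.
have [b _ <-] : range m (bmap_fun v y); last by exists b.
apply: mC; apply: closure_subset (bmap_closure (f := v) (eD y)).
by move=> _ [_ [x _ <-] <-]; exists (u x).
Qed.

(** * T-closed and T-dense morphisms *)

Section Corestriction.
Variables (V W : nspace) (f : mor V W) (S : submodClosed W).
Hypothesis fS : forall x, f x \in S.

Definition corestrict_fun (x : V) : sub_nspace S := Subspace (fS x).

Lemma corestrict_linear : linear corestrict_fun.
Proof. by move=> a x y; apply: val_inj; exact: linearP. Qed.

Definition corestrict : mor V (sub_nspace S) :=
  Mor corestrict_linear (mor_nonexpansive f).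

Lemma corestrictK : compm (sub_incl S) corestrict = f.
Proof. exact: mor_eqP. Qed.

Lemma corestrict_dense : (forall y, y \in S -> closure (range f) y) ->
  dense (range corestrict).
Proof.
move=> Scl; apply/denseP => -[y Sy]; apply/snorm_closureP => r r0.
have /snorm_closureP/(_ r r0)[_ [x _ <-] yx] := Scl y Sy.
by exists (corestrict x) => //; exists x.
Qed.

End Corestriction.

Lemma range_sub_incl W (S : submodClosed W) :
  range (sub_incl S) = [set` S].
Proof.
apply/seteqP; split=> [_ [x _ <-]|y Sy]; first exact: subspace_valP.
by exists (Subspace Sy).
Qed.

Lemma sub_closure_closed W (S : submodClosed W) :
  closed (range (sub_incl (sub_closure S))).
Proof.
rewrite range_sub_incl.
have -> : [set` sub_closure S] = closure [set` S].
  by apply/seteqP; split=> x /=; rewrite inE.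
exact: closed_closure.
Qed.

Lemma closure_factor V W (f : mor V W) (S : submodClosed W) :
  range f = [set` S] -> exists2 e : mor V (sub_nspace (sub_closure S)),
    dense (range e) & f = compm (sub_incl (sub_closure S)) e.
Proof.
move=> fS.
have fcl x : f x \in sub_closure S.
  by rewrite inE; apply: subset_closure; rewrite -fS; exists x.
exists (corestrict fcl); last by rewrite corestrictK.
by apply: corestrict_dense => y; rewrite inE -fS.
Qed.

Lemma range_range_pred V W (f : mor V W) : range f = [set` range_pred f].
Proof. by apply/seteqP; split=> x /=; rewrite inE. Qed.

(** For the direct implication, the lift of the identity against the dense
    isometric embedding of the range of [f] into its closure shows that the
    closure is contained in the range. *)
Lemma T_closedE V W (f : mor V W) :
  T_closed T F f <-> isometric_embedding f /\ closed (range f).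
Proof.
split=> [[fM fR]|[fM fC]]; last first.
  split=> // A1 A2 e /Sigma_dense eD; exact: dense_orthogonal_closed.
split=> //; have [fI fN] := fM.
have [e eD fE] := closure_factor (range_range_pred f).
have fex x : f x = subspace_val (e x) := congr1 (fun g : mor _ _ => g x) fE.
have eM : isometric_embedding e.
  by split=> [x y exy|x]; [apply: fI; rewrite !fex exy|rewrite -fN fex].
have [|h [_ hi]] := orthogonal_lift (f := idm V) (g := sub_incl _)
  (fR _ _ _ (dense_isometric_Sigma eM eD)).
  by rewrite -fE; exact: mor_eqP.
suff <- : range (sub_incl (sub_closure (range_pred f))) = range f.
  exact: sub_closure_closed.
apply/seteqP; split=> _ [x _ <-].
  by exists (h x) => //; exact: (congr1 (fun g : mor _ _ => g x) hi).
by exists (e x) => //; rewrite [in RHS]fE.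
Qed.

Lemma sub_closure_T_closed W (S : submodClosed W) :
  T_closed T F (sub_incl (sub_closure S)).
Proof.
by apply/T_closedE; split; [exact: incl_isometric|exact: sub_closure_closed].
Qed.

(** For the direct implication, the closure of the range is a T-closed subspace
    through which [f] factors; lifting the identity of the codomain shows that it
    is everything. *)
Lemma T_denseE V W (f : mor V W) : T_dense T F f <-> dense (range f).
Proof.
split=> [fT|fD B1 B2 m /T_closedE[mM mC]]; last first.
  exact: dense_orthogonal_closed.
have [e eD fE] := closure_factor (range_range_pred f).
have [|h [_ hi]] := orthogonal_lift (f := e) (g := idm W)
  (fT _ _ _ (sub_closure_T_closed (range_pred f))).
  by rewrite -fE; exact: mor_eqP.
apply/denseP => y.
have hy : subspace_val (h y) = y := congr1 (fun g : mor W W => g y) hi.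
by have := subspace_valP (h y); rewrite hy inE -range_range_pred.
Qed.

Lemma T_factor V W (f : mor V W) :
  factors_through (T_dense T F) (T_closed T F) f.
Proof.
have [e eD fE] := closure_factor (range_range_pred f).
exists (sub_nspace (sub_closure (range_pred f))), e, (sub_incl _).
by split=> //; [exact/T_denseE|exact: sub_closure_T_closed].
Qed.

Lemma T_closure_sub_incl W (S : submodClosed W) :
  is_T_closure T F (sub_incl S) (sub_incl (sub_closure S)).
Proof.
split; first exact: sub_closure_T_closed.
have [e eD iE] := closure_factor (range_sub_incl S).
by exists e => //; exact/T_denseE.
Qed.

(** Orthogonality of the dense part of each factorization to the closed part of
    the other gives morphisms in both directions over [W]; they are mutually
    inverse because the closed parts are injective. *)
Lemma T_closure_unique V W (m : mor V W) C C' (c : mor C W) (c' : mor C' W) :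
  is_T_closure T F m c -> is_T_closure T F m c' -> iso_over c c'.
Proof.
move=> [cT [e eT mE]] [cT' [e' eT' mE']].
have [|h [_ hE]] := orthogonal_lift (f := e) (g := c') (eT' _ _ _ cT).
  by rewrite -mE.
have [|i [_ iE]] := orthogonal_lift (f := e') (g := c) (eT _ _ _ cT').
  by rewrite -mE'.
have [[[cI _] _] [[cI' _] _]] := (cT, cT').
have hx x : c (h x) = c' x := congr1 (fun g : mor _ _ => g x) hE.
have ix x : c' (i x) = c x := congr1 (fun g : mor _ _ => g x) iE.
exists i => //; exists h; split; apply: mor_eqP => x.
  by apply: cI; rewrite /= hx ix.
by apply: cI'; rewrite /= ix hx.
Qed.

End DoubleDualDensity.

Theorem theorem7p2 (R : realType) (k : scalar_kind) (d : norm_kind) :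
  let T := @double_dual R k d in
  let F := @surj_isom R k d in
  [/\ forall (V W : nspace R k d) (f : mor V W),
        T_dense T F f <-> dense (range f),
      forall (V W : nspace R k d) (f : mor V W),
        T_closed T F f <-> isometric_embedding f /\ closed (range f),
      forall (V W : nspace R k d) (f : mor V W),
        factors_through (T_dense T F) (T_closed T F) f
    & forall (W : nspace R k d) (S : submodClosed W),
        is_T_closure T F (sub_incl S) (sub_incl (sub_closure S)) /\
        forall (C : nspace R k d) (c : mor C W),
          is_T_closure T F (sub_incl S) c -> iso_over c (sub_incl (sub_closure S))].
Proof.
split; [exact: T_denseE|exact: T_closedE|exact: T_factor|move=> W S].
split=> [|C c cT]; first exact: T_closure_sub_incl.
exact: T_closure_unique cT (T_closure_sub_incl S).
Qed.
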